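(* Let $0\leq w\leq 1$, and let $\pi\colon (X,T)\to (Y,S)$ be an equivariant continuous map between dynamical systems. Then, for every subset $\Omega\subset X$ (not assumed to be $T$-invariant or closed), we have $$h_{\mathrm{FH}}^w(\Omega,T)\leq h_{\mathrm{top}}^w(\Omega,T),$$ where $h_{\mathrm{FH}}^w(\Omega,T)$ is Feng--Huang's $w$-weighted topological entropy of $\Omega$ and $h_{\mathrm{top}}^w(\Omega,T)$ is the covering $w$-weighted topological entropy of $\Omega$, both taken with respect to $\pi$.
   Context: A dynamical system $(X,T)$ is a compact metric space $X$ together with a continuous map $T\colon X\to X$. An equivariant continuous map $\pi\colon (X,T)\to(Y,S)$ is a continuous map $\pi\colon X\to Y$ with $\pi\circ T=S\circ\pi$ (not assumed surjective). Let $\mathbf{d}$ and $\mathbf{d}'$ be the metrics on $X$ and $Y$. For a natural number $n\ge 1$ put $\mathbf{d}_n(x,x')=\max_{0\leq k<n}\mathbf{d}(T^kx,T^kx')$ and $\mathbf{d}'_n(y,y')=\max_{0\leq k<n}\mathbf{d}'(S^ky,S^ky')$, with the convention $\mathbf{d}_0=0$. Put $$\mathbf{d}^w_n(x,x')=\max\left(\mathbf{d}_{\lceil wn\rceil}(x,x'),\ \mathbf{d}'_n(\pi(x),\pi(x'))\right),\qquad B^w_n(x,\varepsilon)=\{x'\in X\mid \mathbf{d}^w_n(x,x')<\varepsilon\}.$$ Feng--Huang entropy. For $\Omega\subset X$, $N\in\mathbb{N}$, $s\geq 0$, $\varepsilon>0$, let $\Lambda^{w,s}_{N,\varepsilon}(\Omega)=\inf\sum_i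 e^{-sn_i}$, the infimum being over all at most countable coverings $\Omega\subset\bigcup_i B^w_{n_i}(x_i,\varepsilon)$ with $x_i\in X$ and integers $n_i\geq N$. This is nondecreasing in $N$; let $\Lambda^{w,s}_{\varepsilon}(\Omega)=\lim_{N\to\infty}\Lambda^{w,s}_{N,\varepsilon}(\Omega)$. There is a unique critical value $h_{\mathrm{FH}}^w(\Omega,T,\varepsilon)\in[0,\infty]$ such that $\Lambda^{w,s}_\varepsilon(\Omega)=\infty$ for $s<h_{\mathrm{FH}}^w(\Omega,T,\varepsilon)$ and $\Lambda^{w,s}_\varepsilon(\Omega)=0$ for $s>h_{\mathrm{FH}}^w(\Omega,T,\varepsilon)$ (for nonempty $\Omega$). Define $h_{\mathrm{FH}}^w(\Omega,T)=\lim_{\varepsilon\to 0}h_{\mathrm{FH}}^w(\Omega,T,\varepsilon)$, and $h_{\mathrm{FH}}^w(\emptyset,T)=-\infty$. Covering entropy. For $\Omega\subset X$, $\#(\Omega,\mathbf{d}_n,\varepsilon)$ is the smallest integer $k$ for which there are open subsets $U_1,\dots,U_k$ of $X$ with $\Omega\subset U_1\cup\dots\cup U_k$ and $\mathrm{Diam}(U_i,\mathbf{d}_n)<\varepsilon$ for every $i$ (diameter with respect to $\mathbf{d}_n$). Define $$\#^w(\Omega,n,\varepsilon)=\inf\sum_{j=1}^{\ell}\left(\#(\Omega\cap\pi^{-1}(V_j),\mathbf{d}_n,\varepsilon)\right)^w,$$ the infimum being over all finite families $V_1,\dots,V_\ell$ of open subsets of $Y$ with $\pi(\Omega)\subset V_1\cup\dots\cup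 V_\ell$ and $\mathrm{Diam}(V_j,\mathbf{d}'_n)<\varepsilon$ for every $j$; the $j$-th term is set to $0$ whenever $\Omega\cap\pi^{-1}(V_j)=\emptyset$ (also when $w=0$). Define $$h_{\mathrm{top}}^w(\Omega,T)=\lim_{\varepsilon\to0}\left(\limsup_{n\to\infty}\frac{\log\#^w(\Omega,n,\varepsilon)}{n}\right),$$ and $h_{\mathrm{top}}^w(\emptyset,T)=-\infty$. *)

(* Defs.v *)
From mathcomp Require Import all_boot all_order all_algebra.
From mathcomp Require Import all_classical all_reals all_analysis.
From mathcomp Require Import lra.

Set Implicit Arguments.
Unset Strict Implicit.
Unset Printing Implicit Defensive.

Import Order.TTheory GRing.Theory Num.Theory.
Import numFieldNormedType.Exports.

Local Open Scope classical_set_scope.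
Local Open Scope ring_scope.

(* The default value 0 of the maximum gives the convention d_0 = 0; it is
   harmless for n > 0 because distances are nonnegative. *)
Definition bowen_dist (R : realType) (X : metricType R) (T : X -> X) (n : nat)
    (x x' : X) : R :=
  \big[Num.max/0]_(k < n) mdist (iter k T x) (iter k T x').

(* [ereal_sup set0] is -oo: the maximum with 0 makes the diameter of the empty
   set equal to 0. *)
Definition diam (R : realType) (X : Type) (d : X -> X -> R) (U : set X) :
    \bar R :=
  maxe 0%E (ereal_sup [set (d p.1 p.2)%:E | p in U `*` U]).

Section feng_huang_entropy.
Context (R : realType) (X Y : metricType R).
Implicit Types (T : X -> X) (S : Y -> Y) (phi : X -> Y) (w s e : R).
Implicit Types (Om : set X) (n N : nat).

Definition weighted_dist T S phi w n (x x' : X) : R :=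
  Num.max (bowen_dist T `|Num.ceil (w * n%:R)|%N x x')
          (bowen_dist S n (phi x) (phi x')).

Definition weighted_ball T S phi w n (x : X) e : set X :=
  [set x' | weighted_dist T S phi w n x x' < e].

Definition FH_pre T S phi w s N e Om : \bar R :=
  ereal_inf [set v | exists (I : countType) (x : I -> X) (n : I -> nat),
    [/\ forall i, (N <= n i)%N,
        Om `<=` \bigcup_i weighted_ball T S phi w (n i) (x i) e
      & v = (\esum_(i in [set: I]) (expR (- (s * (n i)%:R)))%:E)%E]].

Definition FH_premeasure T S phi w s e Om : \bar R :=
  limn (fun N => FH_pre T S phi w s N e Om).

Definition is_FH_critical T S phi w e Om (h : \bar R) : Prop :=
  (0 <= h)%E /\
  forall s, 0 <= s ->
    ((s%:E < h)%E -> FH_premeasure T S phi w s e Om = +oo%E) /\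
    ((h < s%:E)%E -> FH_premeasure T S phi w s e Om = 0%E).

Definition FH_entropy_at T S phi w e Om : \bar R :=
  [get h | is_FH_critical T S phi w e Om h].

Definition FH_entropy T S phi w Om : \bar R :=
  if Om == set0 then -oo%E
  else lim (FH_entropy_at T S phi w e Om @[e --> 0^'+]).

End feng_huang_entropy.

(* Equal to +oo if no finite cover exists, which does not happen when X is
   compact and d is continuous. *)
Definition cover_number (R : realType) (X : topologicalType) (d : X -> X -> R)
    (e : R) (Om : set X) : \bar R :=
  ereal_inf [set k%:R%:E | k in [set k : nat | exists U : 'I_k -> set X,
    [/\ forall i, open (U i), Om `<=` \bigcup_i U i
      & forall i, (diam d (U i) < e%:E)%E]]].

Section covering_entropy.
Context (R : realType) (X Y : metricType R).
Implicit Types (T : X -> X) (S : Y -> Y) (phi : X -> Y) (w e : R).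
Implicit Types (Om : set X) (n : nat).

Definition weighted_cover_number T S phi w n e Om : \bar R :=
  ereal_inf [set v | exists (l : nat) (V : 'I_l -> set Y),
    [/\ forall j, open (V j), phi @` Om `<=` \bigcup_j V j,
        forall j, (diam (bowen_dist S n) (V j) < e%:E)%E
      & v = (\sum_(j < l)
               if Om `&` phi @^-1` V j == set0 then 0
               else cover_number (bowen_dist T n) e
                      (Om `&` phi @^-1` V j) `^ w)%E]].

(* The term n = 0 has no influence on the upper limit. *)
Definition top_entropy_at T S phi w e Om : \bar R :=
  limn_esup (fun n =>
    (lne (weighted_cover_number T S phi w n e Om) * (n%:R^-1)%:E)%E).

Definition top_entropy T S phi w Om : \bar R :=
  if Om == set0 then -oo%E
  else lim (top_entropy_at T S phi w e Om @[e --> 0^'+]).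

End covering_entropy.

(* The critical value exists and is unique, and the limits for N --> oo and
   e --> 0 exist, so no [get], [limn] or [lim] above takes an arbitrary default
   value. *)
Section well_definedness.
Context (R : realType) (X Y : metricType R).
Context (T : X -> X) (S : Y -> Y) (phi : X -> Y) (w : R) (Om : set X).

Lemma FH_pre_ge0 s N e : (0 <= FH_pre T S phi w s N e Om)%E.
Proof.
apply: le_ereal_inf_tmp => _ /= [I [x [n [_ _ ->]]]].
by apply: esum_ge0 => i _; rewrite lee_fin expR_ge0.
Qed.

Lemma FH_pre_nondecreasing s e :
  {homo (fun N => FH_pre T S phi w s N e Om) : N M / (N <= M)%N >-> (N <= M)%E}.
Proof.
move=> N M NM; apply: ereal_inf_le_tmp => v /= [I [x [n [nN c ->]]]].
by exists I, x, n; split=> // i; exact: leq_trans (nN i).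
Qed.

Lemma is_cvg_FH_pre s e : cvgn (fun N => FH_pre T S phi w s N e Om).
Proof. exact: ereal_nondecreasing_is_cvgn (FH_pre_nondecreasing s e). Qed.

Lemma FH_premeasureE s e : FH_premeasure T S phi w s e Om =
  ereal_sup (range (fun N => FH_pre T S phi w s N e Om)).
Proof.
by apply: cvg_lim => //; apply: ereal_nondecreasing_cvgn;
  exact: FH_pre_nondecreasing.
Qed.

Lemma FH_pre_scale s t N e : s <= t ->
  ((expR ((t - s) * N%:R))%:E * FH_pre T S phi w t N e Om
   <= FH_pre T S phi w s N e Om)%E.
Proof.
move=> st; apply: le_ereal_inf_tmp => _ /= [I [x [n [nN c ->]]]].
set E := expR _.
have E0 : 0 < E by exact: expR_gt0.
apply: (@le_trans _ _
  (E%:E * \esum_(i in [set: I]) (expR (- (t * (n i)%:R)))%:E)%E).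
  rewrite lee_pmul2l//; apply: ereal_inf_lbound; by exists I, x, n.
set b := (X in (_ <= X)%E).
have -> : b = (E%:E * (E^-1%:E * b))%E.
  by rewrite muleA -EFinM divff ?mul1e// gt_eqF.
rewrite lee_pmul2l//; apply: ge_ereal_sup => _ /= [A AI <-].
apply: (@le_trans _ _
  (E^-1%:E * \sum_(i \in A) (expR (- (s * (n i)%:R)))%:E)%E).
  rewrite ge0_mule_fsumr; last by move=> i; rewrite lee_fin expR_ge0.
  have [fA _] := AI.
  apply: lee_fsum => // i _; rewrite -EFinM lee_fin.
  rewrite /E -expRN -expRD ler_expR.
  have : (t - s) * N%:R <= (t - s) * (n i)%:R.
    by rewrite ler_wpM2l ?subr_ge0// ler_nat.
  lra.
rewrite lee_pmul2l ?lte_fin ?invr_gt0//.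
apply: ereal_sup_ubound; by exists A.
Qed.

Lemma FH_premeasure_nonincreasing e s t : s <= t ->
  (FH_premeasure T S phi w t e Om
   <= FH_premeasure T S phi w s e Om)%E.
Proof.
move=> st; rewrite !FH_premeasureE; apply: ge_ereal_sup => _ /= [N _ <-].
apply: (@le_trans _ _ (FH_pre T S phi w s N e Om)); last first.
  by apply: ereal_sup_ubound; exists N.
apply: (le_trans _ (FH_pre_scale N e st)).
rewrite -{1}(mul1e (FH_pre _ _ _ _ t _ _ _)).
apply: lee_wpmul2r; first exact: FH_pre_ge0.
by rewrite lee_fin -expR0 ler_expR mulr_ge0// subr_ge0.
Qed.

Lemma FH_premeasure_pinfty e s t :
  s < t -> FH_premeasure T S phi w t e Om != 0%E ->
  FH_premeasure T S phi w s e Om = +oo%E.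
Proof.
move=> st nz.
have [N0 c0] : exists N0, (0 < FH_pre T S phi w t N0 e Om)%E.
  apply: contrapT => /forallNP h; move/eqP: nz; apply; rewrite FH_premeasureE.
  apply/eqP; rewrite eq_le; apply/andP; split.
    by apply: ge_ereal_sup => _ /= [N _ <-]; rewrite leNgt; exact/negP.
  apply: (le_trans (FH_pre_ge0 t 0%N e) _); apply: ereal_sup_ubound.
  by exists 0%N.
have [c [cp cle]] : exists c : R,
    0 < c /\ (c%:E <= FH_pre T S phi w t N0 e Om)%E.
  move: c0; case: (FH_pre _ _ _ _ _ _ _ _) => [r| |] // r0.
    by exists r.
  by exists 1; rewrite leey.
apply/eqyP => A A0.
pose M := maxn N0 (Num.truncn (A / (c * (t - s)))).+1.
apply: (@le_trans _ _ (FH_pre T S phi w s M e Om)); last first.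
  by rewrite FH_premeasureE; apply: ereal_sup_ubound; exists M.
apply: (le_trans _ (FH_pre_scale M e (ltW st))).
apply: (@le_trans _ _ ((expR ((t - s) * M%:R))%:E * c%:E)%E); last first.
  rewrite lee_pmul2l// ?lte_fin ?expR_gt0//; apply: le_trans cle _.
  by apply: FH_pre_nondecreasing; exact: leq_maxl.
rewrite -EFinM lee_fin.
have ts0 : 0 < t - s by rewrite subr_gt0.
have h1 : 1 + (t - s) * M%:R <= expR ((t - s) * M%:R) by exact: expR_ge1Dx.
have h2 : A / (c * (t - s)) <= M%:R.
  apply: (le_trans (ltW (truncnS_gt _))); rewrite ler_nat; exact: leq_maxr.
move: h2; rewrite ler_pdivrMr ?mulr_gt0// => h2.
apply: (@le_trans _ _ ((1 + (t - s) * M%:R) * c)); last by rewrite ler_pM2r.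
by rewrite mulrDl mul1r; nra.
Qed.

Definition FH_critical e := ereal_inf
  [set s%:E | s in [set s | 0 <= s /\ FH_premeasure T S phi w s e Om = 0%E]].

Lemma FH_criticalP e : is_FH_critical T S phi w e Om (FH_critical e).
Proof.
split; first by apply: le_ereal_inf_tmp => _ /= [s [s0 _] <-]; rewrite lee_fin.
move=> s s0; split => [sh|/ereal_inf_lt[_ /= [t [t0 tz] <-]]].
  have [t st th] : exists2 t, s < t & (t%:E < FH_critical e)%E.
    move: sh; case: (FH_critical e) => [r| |]//; rewrite ?lte_fin => sr.
      by exists ((s + r) / 2); rewrite ?lte_fin ?midf_lt.
    by exists (s + 1); rewrite ?ltry// ltrDl.
  apply: (FH_premeasure_pinfty st); apply/eqP => tz.
  move: th; apply/negP; rewrite -leNgt.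
  by apply: ereal_inf_lbound; exists t => //; split => //;
    apply: (le_trans s0 (ltW st)).
rewrite lte_fin => ts; apply/eqP; rewrite eq_le; apply/andP; split.
  by rewrite -tz; exact: FH_premeasure_nonincreasing (ltW ts).
rewrite FH_premeasureE; apply: (le_trans (FH_pre_ge0 s 0%N e) _).
apply: ereal_sup_ubound; by exists 0%N.
Qed.

Lemma is_FH_critical_unique e h h' :
  is_FH_critical T S phi w e Om h -> is_FH_critical T S phi w e Om h' -> h = h'.
Proof.
wlog hh : h h' / (h < h')%E.
  by move=> W c c'; have [/W-> //|/W-> //|//] := ltgtP h h'.
move=> [h0 c] [h'0 c'].
have [s hs sh] : exists2 s, (h < s%:E)%E & (s%:E < h')%E.
  move: h0 hh; case: h {c} => [r| |]//; case: h' {c' h'0} => [r'| |]//;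
    rewrite ?lte_fin => r0 sr.
    by exists ((r + r') / 2); rewrite ?lte_fin ?midf_lt.
  by exists (r + 1); rewrite ?ltry// lte_fin ltrDl.
have s0 : 0 <= s by rewrite -lee_fin; exact: le_trans h0 (ltW hs).
by have := (c s s0).2 hs; rewrite (c' s s0).1.
Qed.

Lemma FH_entropy_atE e : FH_entropy_at T S phi w e Om = FH_critical e.
Proof.
apply: (@is_FH_critical_unique e); last exact: FH_criticalP.
by apply: (@getPex _ (is_FH_critical T S phi w e Om));
  exists (FH_critical e); exact: FH_criticalP.
Qed.

Lemma FH_pre_le_eps s N e e' : e <= e' ->
  (FH_pre T S phi w s N e' Om <= FH_pre T S phi w s N e Om)%E.
Proof.
move=> ee; apply: ereal_inf_le_tmp => v /= [I [x [n [nN c ->]]]].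
exists I, x, n; split=> // z /c [i _ zi]; exists i => //.
exact: lt_le_trans zi ee.
Qed.

Lemma is_cvg_FH_entropy_at : cvg (FH_entropy_at T S phi w e Om @[e --> 0^'+]).
Proof.
apply: nonincreasing_at_right_is_cvge; near=> z => e e' _ _ ee.
rewrite !FH_entropy_atE; apply: ereal_inf_le_tmp => _ /= [s [s0 sz] <-].
exists s => //; split => //; apply/eqP; rewrite eq_le; apply/andP; split.
  rewrite -sz !FH_premeasureE; apply: ge_ereal_sup => _ /= [N _ <-].
  apply: (le_trans (FH_pre_le_eps s N ee) _).
  apply: ereal_sup_ubound; by exists N.
rewrite FH_premeasureE; apply: (le_trans (FH_pre_ge0 s 0%N e') _).
apply: ereal_sup_ubound; by exists 0%N.
Unshelve. all: by end_near.
Qed.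

Lemma cover_number_ge0 (Z : topologicalType) (d : Z -> Z -> R) e O :
  (0 <= cover_number d e O)%E.
Proof. by apply: le_ereal_inf_tmp => _ /= [k _ <-]; rewrite lee_fin. Qed.

Lemma cover_number_le_eps (Z : topologicalType) (d : Z -> Z -> R) e e' O :
  e <= e' -> (cover_number d e' O <= cover_number d e O)%E.
Proof.
move=> ee; apply: ereal_inf_le_tmp => _ /= [k [U [oU c D]] <-]; exists k => //.
by exists U; split => // i; apply: (lt_le_trans (D i) _); rewrite lee_fin.
Qed.

Lemma weighted_cover_number_ge0 n e :
  (0 <= weighted_cover_number T S phi w n e Om)%E.
Proof.
apply: le_ereal_inf_tmp => _ /= [l [V [_ _ _ ->]]].
by apply: sume_ge0 => j _; case: ifP => // _; exact: poweR_ge0.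
Qed.

Lemma is_cvg_top_entropy_at : 0 <= w ->
  cvg (top_entropy_at T S phi w e Om @[e --> 0^'+]).
Proof.
move=> w0; apply: nonincreasing_at_right_is_cvge; near=> z => e e' _ _ ee.
rewrite /top_entropy_at /limn_esup !limf_esupE.
apply: le_ereal_inf_tmp => _ /= [F FF <-].
apply: (@le_trans _ _ (ereal_sup
  [set (lne (weighted_cover_number T S phi w n e' Om) * (n%:R^-1)%:E)%E | n in F])).
  by apply: ereal_inf_lbound; exists F.
apply: ge_ereal_sup => _ /= [n Fn <-].
apply: (@le_trans _ _
  (lne (weighted_cover_number T S phi w n e Om) * (n%:R^-1)%:E)%E); last first.
  by apply: ereal_sup_ubound; exists n.
apply: lee_wpmul2r; first by rewrite lee_fin.
rewrite lee_lne ?in_itv/= ?leey ?weighted_cover_number_ge0//.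
apply: le_ereal_inf_tmp => _ /= [l [V [oU c D ->]]].
apply: (@le_trans _ _ (\sum_(j < l) if (Om `&` phi @^-1` V j) == set0 then 0
               else cover_number (bowen_dist T n) e'
                      (Om `&` phi @^-1` V j) `^ w)%E).
  apply: ereal_inf_lbound; exists l, V; split => // j.
  by apply: (lt_le_trans (D j) _); rewrite lee_fin.
apply: lee_sum => j _; case: ifP => // _.
by apply: gt0_ler_poweR => //; rewrite ?in_itv/= ?leey ?cover_number_ge0//
  cover_number_le_eps.
Unshelve. all: by end_near.
Qed.

End well_definedness.

(* Main.v *)
Require Import Defs.
From mathcomp Require Import all_boot all_order all_algebra.
From mathcomp Require Import all_classical all_reals all_analysis.
From mathcomp Require Import ring lra.
Import Order.TTheory GRing.Theory Num.Theory.
Import numFieldNormedType.Exports.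

Set Implicit Arguments.
Unset Strict Implicit.

Local Open Scope classical_set_scope.
Local Open Scope ring_scope.

(** Why the inequality holds. Fix a scale [e]. It suffices to exhibit, for
    every rate [s] slightly above the covering entropy, covers of [Om] by
    weighted balls of large length whose weight [\sum exp (- s n_i)] is as small
    as desired.

    Suppose first that [Y] had a finite partition into small sets which are also
    open. The cell of [x] at level [n] consists of the points whose images have
    the same itinerary of length [n]; let [a_n x] be the number of sets of small
    [d_n]-diameter needed to cover it. Optimal covers at level [n] give
    [\sum_c a_n(c)^w <= exp (h n)], the sum being over the cells. Put
    [n' = ceil (w n)]. Because a cell of level [n] determines the cell of level
    [n'] around it, the points with [a_n' x <= exp (d n) * (a_n x)^w] lie in at
    most [exp (d n) * \sum_c a_n(c)^w <= exp ((h + d) n)] sets of small weighted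
    diameter of order [n] ([good_level_covered]). And every point satisfies this
    inequality at one of boundedly many levels of the chain [n], [n'], [n''] and
    so on: otherwise the normalised logarithms [ln a_n / n] would increase by
    about [d / w] at each step down the chain, although they are bounded by the
    logarithm of the size of a cover of [X] ([chain_descent]).

    A general [Y] has no such partition, so an optimal cover set [V] of small
    [d'_n]-diameter may meet exponentially many cells. Itineraries of two points
    of [V] can differ only at the times when the orbit of one of them is near
    the boundary of the partition. This is controlled with finitely many
    partitions instead of one: they come from balls with the same finitely many
    centres and with [M] well separated radii, so that each point of [Y] is near
    the boundary of at most [D] of them, with [D] independent of [M]
    ([shifted_partitions]). By averaging, each orbit has a partition for which
    the frequency of bad times is at most a constant over [M], at all levels of
    the chain simultaneously ([average_good]). Hence [Om] splits into [M]
    pieces, and on each of them a set [V] meets at most [exp (d n)] cells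
    ([card_itineraries]). The number of pieces and the length of the chain do
    not depend on [n], so they do not affect the exponential rate
    ([FH_pre_le0]). *)

(** * Counting sets of small diameter *)

Section coverings.
Context (R : realType) (Z : Type).
Implicit Types (d : Z -> Z -> R) (e : R) (A B : set Z) (k : nat).

Definition small d e A := forall z z', A z -> A z' -> d z z' < e.

Definition covered d e A k := exists2 U : 'I_k -> set Z,
  A `<=` \bigcup_i U i & forall i, small d e (U i).

(** Unlike [cover_number], this allows arbitrary covering sets, so that pieces of
    itinerary cells can be counted with it, and it takes values in [nat]; the
    default [0] is only reached when no finite cover exists. *)
Definition covnum d e A : nat :=
  if pselect (exists k, `[< covered d e A k >]) is left h then ex_minn h else 0%N.

Lemma small_sub d e A B : A `<=` B -> small d e B -> small d e A.
Proof. by move=> AB sB z z' /AB Bz /AB; exact: sB. Qed.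

Lemma covered_fin d e A (I : finType) (U : I -> set Z) :
  A `<=` \bigcup_i U i -> (forall i, small d e (U i)) -> covered d e A #|I|.
Proof.
move=> AU sU; exists (fun i => U (enum_val i)) => [z /AU[i _ Uz]|i]; last exact: sU.
by exists (enum_rank i) => //; rewrite enum_rankK.
Qed.

Lemma covered_sub d e A B k : A `<=` B -> covered d e B k -> covered d e A k.
Proof. by move=> AB [U BU sU]; exists U => // z /AB /BU. Qed.

Lemma covered_bigcup d e A (J : finType) (B : J -> set Z) (k : J -> nat) :
  A `<=` \bigcup_j B j -> (forall j, covered d e (B j) (k j)) ->
  covered d e A (\sum_j k j)%N.
Proof.
move=> AB covB.
have cB j : {U : 'I_(k j) -> set Z | B j `<=` \bigcup_i U i &
  forall i, small d e (U i)} by exact/cid2/covB.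
pose U (u : {j : J & 'I_(k j)}) : set Z := s2val (cB (tag u)) (tagged u).
have -> : (\sum_j k j)%N = #|{: {j : J & 'I_(k j)}}|.
  rewrite card_tagged sumnE big_map big_enum /=.
  by apply: eq_bigr => j _; rewrite card_ord.
apply: (@covered_fin _ _ _ _ U) => [z /AB[j _ Bz]|[j i]]; rewrite /U /=.
  have [i _ Uz] := s2valP (cB j) z Bz; by exists (Tagged (fun j => 'I_(k j)) i).
exact: (s2valP' (cB j)).
Qed.

Lemma covnumP d e A k : covered d e A k ->
  covered d e A (covnum d e A) /\ (covnum d e A <= k)%N.
Proof.
move=> cA; rewrite /covnum; case: pselect => [h|[]]; last first.
  by exists k; exact/asboolP.
by case: ex_minnP => m /asboolP cm mP; split=> //; apply/mP/asboolP.
Qed.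

Lemma covnum_gt0 d e A k : covered d e A k -> A !=set0 -> (0 < covnum d e A)%N.
Proof.
move=> /covnumP[[U AU _] _] [z /AU[i _ _]]; exact: leq_ltn_trans (ltn_ord i).
Qed.

Lemma covnum0 d e : covnum d e set0 = 0%N.
Proof.
apply/eqP; rewrite -leqn0; apply: (covnumP _).2.
by exists (fun _ => set0) => // -[].
Qed.

Lemma covnum_bigcup d e A (J : finType) (P : pred J) (B : J -> set Z) K :
  covered d e setT K -> A `<=` \bigcup_(j in [set j | P j]) B j ->
  (covnum d e A <= \sum_(j | P j) covnum d e (B j))%N.
Proof.
move=> cT AB; rewrite big_mkcond /=.
rewrite (eq_bigr (fun j => covnum d e (if P j then B j else set0))); last first.
  by move=> j _; case: ifP; rewrite ?covnum0.
apply: (covnumP _).2.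
apply: (@covered_bigcup _ _ _ _ (fun j => if P j then B j else set0)).
  move=> z /AB[j /= Pj Bz].
  by exists j => //; rewrite Pj.
by move=> j; apply: (covnumP _).1; apply: covered_sub cT.
Qed.

End coverings.

(** * Bowen metrics and Feng--Huang sums *)

Section bowen.
Context (R : realType).
Implicit Types (X Y : metricType R) (e : R) (n k : nat).

Lemma small_diam (Z : Type) (d : Z -> Z -> R) e (U : set Z) :
  (diam d U < e%:E)%E -> small d e U.
Proof.
move=> dU z z' Uz Uz'; rewrite -lte_fin; apply: le_lt_trans dU.
rewrite /diam le_max; apply/orP; right; apply: ereal_sup_ubound.
by exists (z, z').
Qed.

(** The only passage from the open covers that define the covering entropy to
    the arbitrary covers used below. *)
Lemma covnum_le_cover_number (Z : topologicalType) (d : Z -> Z -> R) e e' A :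
  e' <= e -> ((covnum d e A)%:R%:E <= cover_number d e' A)%E.
Proof.
move=> ee; apply: le_ereal_inf_tmp => _ [k [U [_ AU dU]] <-].
rewrite lee_fin ler_nat; apply: (covnumP _).2.
by exists U => // i z z' Uz Uz'; apply: lt_le_trans ee; exact: (small_diam (dU i)).
Qed.

Lemma bowen_dist_lt X (T : X -> X) n e (x x' : X) : 0 < e ->
  bowen_dist T n x x' < e <->
  (forall k, (k < n)%N -> mdist (iter k T x) (iter k T x') < e).
Proof.
move=> e0; rewrite /bowen_dist; split=> [/bigmax_ltP[_ h] k kn|h].
  exact: (h (Ordinal kn)).
by apply/bigmax_ltP; split=> // k _; exact: h.
Qed.

(** A cover of [X] by [C] sets yields one for [d_n], indexed by the words of
    length [n] in [C] letters: follow the sets visited by the orbit. *)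
Lemma covered_bowen X (T : X -> X) n e C : 0 < e ->
  covered (@mdist R X) e setT C -> covered (bowen_dist T n) e setT (C ^ n)%N.
Proof.
move=> e0 [U TU sU].
pose V (f : {ffun 'I_n -> 'I_C}) : set X :=
  [set x | forall k : 'I_n, U (f k) (iter k T x)].
rewrite -[X in (X ^ _)%N]card_ord -[X in (_ ^ X)%N]card_ord -card_ffun.
apply: (@covered_fin _ _ _ _ _ _ V) => [x _|f x x' Vx Vx'].
  have g (k : 'I_n) : exists i, U i (iter k T x).
    by have [i _ ?] := TU (iter k T x) I; exists i.
  exists [ffun k => projT1 (cid (g k))] => // k /=.
  by rewrite ffunE; case: cid.
apply/bowen_dist_lt => // k kn.
exact: sU (Vx (Ordinal kn)) (Vx' (Ordinal kn)).
Qed.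

(** Compactness is applied along the filter of finite sets of centres, ordered
    by inclusion; this form needs no base point, so [X] may be empty. *)
Lemma compact_net X r : compact [set: X] -> 0 < r ->
  exists D (c : 'I_D -> X), forall x, exists j, mdist (c j) x < r.
Proof.
move=> /compact_near_coveringP cX r0.
pose F : set_system (seq X) :=
  [set Q | exists s0 : seq X, forall s : seq X, {subset s0 <= s} -> Q s].
have FF : Filter F.
  split=> [|P Q [s1 P1] [s2 Q2]|P Q PQ [s0 P0]].
  - by exists [::].
  - by exists (s1 ++ s2) => s ss; split; [apply: P1|apply: Q2] => z zs;
      apply: ss; rewrite mem_cat zs ?orbT.
  - by exists s0 => s /P0 /PQ.
have [x _|s0 /(_ s0 (fun _ => id)) net] :=
    cX _ F (fun (s : seq X) x => exists2 y, y \in s & mdist y x < r) FF.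
  exists (ball x r, [set s : seq X | x \in s]) => [|[x' s] /= [xx' xs]].
    split; first exact: nbhsx_ballx.
    by exists [:: x] => s; apply; rewrite mem_head.
  by exists x => //; move: xx'; rewrite ballEmdist.
exists (size s0), (fun j : 'I_(size s0) => tnth (in_tuple s0) j) => x.
have [y ys yx] := net x I.
have iy : (index y s0 < size s0)%N by rewrite index_mem.
by exists (Ordinal iy); rewrite (tnth_nth y) nth_index.
Qed.

Lemma compact_covered X e : compact [set: X] -> 0 < e ->
  exists C, covered (@mdist R X) e setT C.
Proof.
move=> cX e0; have [|D [c cP]] := @compact_net _ (e / 2) cX; first by rewrite divr_gt0.
exists D, (fun j => [set x | mdist (c j) x < e / 2]) => [x _|j x x' /= cx cx'].
  by have [j ?] := cP x; exists j.
apply: le_lt_trans (metric_triangle _ (c j) _) _.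
by rewrite [e]splitr ltrD // metric_sym.
Qed.

(** A set of weighted diameter less than [e] lies in the weighted ball around any
    of its points, so covers by small sets bound the Feng--Huang sums. The point
    [x0] only serves as the centre attached to an empty covering set. *)
Lemma FH_pre_le X Y (T : X -> X) (S : Y -> Y) (phi : X -> Y) w s N e
    (Om : set X) (J : finType) (B : J -> set X) (n k : J -> nat) (x0 : X) :
  Om `<=` \bigcup_j B j -> (forall j, (N <= n j)%N) ->
  (forall j, covered (weighted_dist T S phi w (n j)) e (B j) (k j)) ->
  (FH_pre T S phi w s N e Om
   <= (\sum_j (k j)%:R * expR (- (s * (n j)%:R)))%:E)%E.
Proof.
move=> OmB nN covB.
have cB j : {U : 'I_(k j) -> set X | B j `<=` \bigcup_i U i &
  forall i, small (weighted_dist T S phi w (n j)) e (U i)} by exact/cid2/covB.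
pose U (u : {j : J & 'I_(k j)}) : set X := s2val (cB (tag u)) (tagged u).
pose x (u : {j : J & 'I_(k j)}) := xget x0 (U u).
apply: ereal_inf_lbound.
exists {j : J & 'I_(k j)}, x, (fun u => n (tag u)); split=> //.
  move=> z /OmB[j _ /(s2valP (cB j))[i _ Uz]].
  exists (Tagged (fun j => 'I_(k j)) i) => //.
  apply: (s2valP' (cB j) i); last exact: Uz.
  rewrite /x; apply: (@xgetPex _ x0 (U (Tagged (fun j => 'I_(k j)) i))); exists z; exact: Uz.
rewrite esum_fset; last 2 first.
- exact: finite_finset.
- by move=> i _; rewrite lee_fin expR_ge0.
have -> : [set: {j : J & 'I_(k j)}] = [set` enum {: {j : J & 'I_(k j)}}].
  by apply/seteqP; split=> // u _ /=; rewrite mem_enum.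
rewrite -fsbig_seq ?enum_uniq // big_enum sumEFin; congr EFin.
rewrite -(sig_big_dep xpredT (fun _ => xpredT)
  (fun j (_ : 'I_(k j)) => expR (- (s * (n j)%:R)))) /=.
by apply: eq_bigr => j _; rewrite sumr_const card_ord mulr_natl.
Qed.

End bowen.

(** * Subadditivity of powers, averaging and counting *)

(** Normalise the sum to [1]: numbers in [0, 1] only grow when raised to the
    power [w <= 1]. Positivity of the sum excludes the empty sum, where the
    claim fails for [w = 0]. *)
Lemma powR_sum_le (R : realType) (I : finType) (P : pred I) (w : R) (x : I -> R) :
  0 <= w <= 1 -> (forall i, 0 <= x i) -> 0 < \sum_(i | P i) x i ->
  (\sum_(i | P i) x i) `^ w <= \sum_(i | P i) x i `^ w.
Proof.
move=> /andP[w0 w1] x0; set s := \sum_(i | P i) x i => s0.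
have key i : P i -> s `^ w * (x i / s) <= x i `^ w.
  move=> Pi; have xs : x i <= s by rewrite /s (bigD1 i) //= lerDl sumr_ge0.
  have [->|xi0] := eqVneq (x i) 0; first by rewrite mul0r mulr0 powR_ge0.
  have xi : 0 < x i by rewrite lt_neqAle eq_sym xi0 x0.
  have -> : x i `^ w = s `^ w * (x i / s) `^ w.
    by rewrite -powRM ?divr_ge0 // 1?ltW // mulrC divfK // gt_eqF.
  rewrite ler_wpM2l ?powR_ge0 // ger1_powR // divr_gt0 //=.
  by rewrite ler_pdivrMr // mul1r.
apply: le_trans (ler_sum _ key).
by rewrite -mulr_sumr -mulr_suml divff ?mulr1 // gt_eqF.
Qed.

(** Averaging over [t] the sum over [i] of the frequencies of bad times below
    [n i] gives at most [L * D / M]; some [t] is not above the average, and then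
    none of its [L] frequencies exceeds this bound. *)
Lemma average_good (R : realFieldType) (M L D : nat) (n : 'I_L -> nat)
    (bad : 'I_M -> nat -> bool) :
  (0 < M)%N -> (forall i, (0 < n i)%N) ->
  (forall k, (#|[set t | bad t k]%SET| <= D)%N) ->
  exists t, forall i, #|[set k : 'I_(n i) | bad t k]%SET|%:R
    <= (L * D)%:R / M%:R * (n i)%:R :> R.
Proof.
move=> M0 n0 badD; apply: contrapT => /forallNP nt.
pose f t i : R := #|[set k : 'I_(n i) | bad t k]%SET|%:R / (n i)%:R.
have f0 t i : 0 <= f t i by rewrite divr_ge0.
have big t : (L * D)%:R / M%:R < \sum_i f t i.
  have /existsNP[i /negP] := nt t; rewrite -ltNge => h.
  rewrite (bigD1 i) //=; apply: ltr_wpDr; first exact: sumr_ge0.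
  by rewrite /f ltr_pdivlMr ?ltr0n.
have : \sum_(t < M) (L * D)%:R / M%:R < \sum_t \sum_i f t i.
  by apply: ltr_sum => //; apply/hasP; exists (Ordinal M0).
rewrite sumr_const card_ord -[_ *+ M]mulr_natr divfK ?pnatr_eq0 -?lt0n //.
apply/negP; rewrite -leNgt exchange_big /= natrM mulr_natl.
have -> : D%:R *+ L = \sum_(i < L) D%:R :> R by rewrite sumr_const card_ord.
apply: ler_sum => i _; rewrite /f -mulr_suml ler_pdivrMr ?ltr0n //.
rewrite -natr_sum -natrM ler_nat.
under eq_bigr do rewrite -sum1_card big_mkcond /=.
rewrite exchange_big /= mulnC -[X in (X * _)%N]card_ord -sum_nat_const.
apply: leq_sum => k _; rewrite -big_mkcond /=; apply: leq_trans (badD k).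
by rewrite -sum1_card; apply: eq_leq; apply: eq_bigl => t; rewrite !inE.
Qed.

Lemma card_agree_off (n : nat) (K : finType) (c0 : {ffun 'I_n -> K})
    (B : {set 'I_n}) :
  (#|[set c : {ffun 'I_n -> K} | [forall k, (k \notin B) ==> (c k == c0 k)]]%SET|
   <= #|K| ^ #|B|)%N.
Proof.
pose F k : pred K := if k \in B then predT else pred1 (c0 k).
rewrite (_ : #|_| = #|(family F : pred _)|); last first.
  apply: eq_card => c; rewrite !inE; apply/forallP/familyP => h k.
    by have := h k; rewrite /F; case: ifP.
  by have := h k; rewrite /F; case: ifP.
rewrite card_family foldrE big_map big_enum /=.
rewrite -prod_nat_const [X in (_ <= X)%N]big_mkcond /=.
apply: leq_prod => k _; rewrite /F; case: ifP => _; first exact: max_card.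
by rewrite card1.
Qed.

(** * Descent along the chain of levels *)

Section chain.
Context (R : realType) (w : R).

Definition ceil_mul (n : nat) : nat := `|Num.ceil (w * n%:R)|%N.

Lemma ceil_mulE n : 0 <= w -> (ceil_mul n)%:R = (Num.ceil (w * n%:R))%:~R :> R.
Proof.
move=> w0; rewrite /ceil_mul natr_absz ger0_norm // ceil_ge0.
by rewrite (lt_le_trans (ltrN10 R)) // mulr_ge0.
Qed.

Lemma ceil_mul_ge n : 0 <= w -> w * n%:R <= (ceil_mul n)%:R.
Proof. by move=> w0; rewrite ceil_mulE // ceil_ge. Qed.

Lemma ceil_mul_leD1 n : 0 <= w -> (ceil_mul n)%:R <= w * n%:R + 1.
Proof.
move=> w0; rewrite ceil_mulE // -lerBlDr ltW //.
by have /andP[] := ceil_itv (w * n%:R); rewrite intrB.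
Qed.

Lemma ceil_mul_le n : 0 <= w <= 1 -> (ceil_mul n <= n)%N.
Proof.
move=> /andP[w0 w1]; rewrite -(ler_nat R) ceil_mulE //.
rewrite -[leRHS]/(n%:Z%:~R) ler_int ceil_le_int.
by rewrite -[leRHS]mul1r ler_wpM2r.
Qed.

(** If [w * a i + d * n_i < a i.+1] for all [i < L], where [n_i] is the level
    reached after [i] steps, then [w^i * n <= n_i] gives by induction
    [i * d * w^i * n <= w * a i]; at [i = L] this contradicts the linear bound on
    [a L] as soon as [L * d > 2 * C + 1] and [n] is large. The length [L] is
    chosen before the lower bound [N] on the levels, since the partitions will
    depend on [L]. *)
Lemma chain_descent (C d : R) : 0 <= w <= 1 -> 0 <= C -> 0 < d ->
  exists L, forall N, exists n,
    (forall i, (i < L)%N -> (N <= iter i ceil_mul n)%N) /\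
    forall a : nat -> R, (forall i, 0 <= a i) ->
      a L <= C * (iter L ceil_mul n)%:R ->
      exists2 i, (i < L)%N & a i.+1 <= w * a i + d * (iter i ceil_mul n)%:R.
Proof.
move=> /andP[w0 w1] C0 d0.
(* For w = 0 the chain drops to level 0 in one step. *)
have [w00|wpos] := eqVneq w 0.
  exists 1%N => N; exists N; split=> [[]//|a a0]; rewrite /= => a1; exists 0%N => //.
  rewrite w00 mul0r add0r /= (le_trans a1) //.
  have -> : ceil_mul N = 0%N.
    by rewrite /ceil_mul w00 mul0r ceil0.
  by rewrite mulr0 mulr_ge0 // ltW.
have wp : 0 < w by rewrite lt_neqAle eq_sym wpos.
pose L := (Num.truncn ((2 * C + 1) / d)).+1.
have Ld : 2 * C + 1 < L%:R * d.
  by rewrite -ltr_pdivrMr //; exact: truncnS_gt.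
(* The rounding errors of the L steps add up to at most L, hence the L in n. *)
exists L => N; pose n := (Num.truncn ((L + N)%:R / w ^+ L)).+1.
have nL : (L + N)%:R < w ^+ L * n%:R.
  by rewrite mulrC -ltr_pdivrMr ?exprn_gt0 //; exact: truncnS_gt.
have lo i : w ^+ i * n%:R <= (iter i ceil_mul n)%:R.
  elim: i => [|i ih]; first by rewrite expr0 mul1r.
  rewrite exprS -mulrA iterS; apply: le_trans (ceil_mul_ge _ w0).
  exact: ler_wpM2l.
have hi i : (iter i ceil_mul n)%:R <= w ^+ i * n%:R + i%:R.
  elim: i => [|i ih]; first by rewrite expr0 mul1r addr0.
  rewrite iterS; apply: (le_trans (ceil_mul_leD1 _ w0)).
  rewrite -natr1 addrA lerD2r exprS -mulrA.
  apply: le_trans (ler_wpM2l w0 ih) _; rewrite mulrDr lerD2l.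
  by rewrite ler_piMl.
exists n; split=> [i iL|a a0 aL].
  rewrite -(ler_nat R); apply: le_trans (lo i).
  apply: (@le_trans _ _ (w ^+ L * n%:R)).
    by apply: le_trans (ltW nL); rewrite ler_nat leq_addl.
  by rewrite ler_wpM2r // ler_wiXn2l // ltnW.
apply: contrapT => nex.
have bad i : (i < L)%N -> w * a i + d * (iter i ceil_mul n)%:R < a i.+1.
  by move=> iL; rewrite ltNge; apply/negP => h; apply: nex; exists i.
have grow i : (i <= L)%N -> i%:R * d * (w ^+ i * n%:R) <= w * a i.
  elim: i => [_|i ih iL]; first by rewrite !mul0r mulr_ge0.
  have h1 := ih (ltnW iL); have h2 := bad i iL; have h3 := lo i.
  have h4 : w * (w * a i + d * (w ^+ i * n%:R)) <= w * a i.+1.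
    apply: ler_wpM2l => //; apply: le_trans (ltW h2); rewrite lerD2l.
    by rewrite ler_wpM2l // ltW.
  apply: le_trans h4; rewrite mulrDr -natr1 exprS.
  have := ler_wpM2l w0 h1; lra.
have gL := grow L (leqnn L); have hL := hi L.
have {}aL : w * a L <= C * (w ^+ L * n%:R + L%:R).
  apply: (@le_trans _ _ (1 * a L)); first by rewrite ler_wpM2r.
  by rewrite mul1r (le_trans aL) // ler_wpM2l.
set P := w ^+ L * n%:R in nL gL aL.
have LP : L%:R < P by apply: le_lt_trans nL; rewrite ler_nat leq_addr.
have P0 : 0 < P by apply: le_lt_trans LP.
have := ltr_pM2r P0 (2 * C + 1) (L%:R * d); rewrite Ld.
have : C * L%:R <= C * P by rewrite ler_wpM2l // ltW.
lra.
Qed.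

End chain.

(** * Partitions with rarely visited boundaries *)

Section partitions.
Context (R : realType) (Y : metricType R).

Definition near_boundary (K : finType) (p : Y -> K) (r : R) (y : Y) : bool :=
  `[< exists2 y', mdist y y' < r & p y' != p y >].

(** Partition number [t] sends [y] to the first centre at distance less than
    [rho t]. A point near its boundary has distance about [rho t] to some centre;
    the radii being [2 * r] apart, each of the [D] centres accounts for at most
    one [t]. What matters is that [D], which controls both the number of bad
    partitions of a point and the number of cells, does not depend on [M]. *)
Lemma shifted_partitions e : compact [set: Y] -> 0 < e ->
  exists D, forall M, exists r (p : 'I_M -> Y -> option 'I_D),
    [/\ 0 < r <= e, forall t y y', p t y = p t y' -> mdist y y' < e &
        forall y, (#|[set t | near_boundary (p t) r y]%SET| <= D)%N].
Proof.
move=> cY e0.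
have [|D [c cP]] := @compact_net _ _ (e / 4) cY; first by rewrite divr_gt0.
exists D => M.
pose r := e / (8 * M.+1%:R).
have r0 : 0 < r by rewrite divr_gt0 // mulr_gt0.
have rM : r * M.+1%:R = e / 8.
  by rewrite /r; field; rewrite /= addrC natr1 pnatr_eq0.
pose rho (t : 'I_M) := e / 4 + t%:R * (2 * r).
have rhoe t : e / 4 <= rho t < e / 2.
  have tM : t%:R < M.+1%:R :> R by rewrite ltr_nat ltnS ltnW.
  have := ltr_pM2l r0 t%:R M.+1%:R; rewrite tM rM.
  have : 0 <= t%:R * r by rewrite mulr_ge0 // ltW.
  rewrite /rho; move=> h1 h2; apply/andP; split; lra.
exists r, (fun t y => [pick j | mdist (c j) y < rho t]); split=> [|t y y'|y].
- rewrite r0 /=; have : r * 1 <= r * M.+1%:R by rewrite ler_pM2l // ler1n.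
  rewrite rM; lra.
- case: pickP => [j jy|none _]; last first.
    by have [j /lt_le_trans/(_ (andP (rhoe t)).1)] := cP y; rewrite none.
  case: pickP => // j' j'y [jj']; rewrite -{}jj' in j'y.
  apply: le_lt_trans (metric_triangle _ (c j) _) _; rewrite metric_sym.
  have /andP[_ h] := rhoe t; lra.
pose close j (t : 'I_M) := `|mdist (c j) y - rho t| < r.
pose f t := [pick j | close j t].
pose A := [set t | near_boundary (fun y => [pick j | mdist (c j) y < rho t]) r y]%SET.
have fP t : t \in A -> exists2 j, f t = Some j & close j t.
  rewrite inE => /asboolP[y' yy' neq]; rewrite /f.
  case: pickP => [j jt|far]; first by exists j.
  case/eqP: neq; apply: eq_pick => j /=.
  move/negbT: (far j); rewrite /close -leNgt ler_normr => h.
  have := metric_triangle (c j) y y'; have := metric_triangle (c j) y' y.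
  rewrite (metric_sym y' y) => h1 h2.
  by apply/idP/idP => h3; case/orP: h => h4; lra.
have apart j (t t' : 'I_M) : (t < t')%N -> close j t -> close j t' -> False.
  rewrite -(ler_nat R) -natr1 /close /rho !ltr_norml => h.
  move=> /andP[h1 h2] /andP[h3 h4]; have := ler_wpM2r (ltW r0) h; lra.
have finj : {in A &, injective f}.
  move=> t t' /fP[j -> jt] /fP[j' -> jt'] [jj]; rewrite -{j'}jj in jt'.
  apply: contrapT => /eqP; rewrite -val_eqE neq_ltn => /orP[] tt.
    exact: apart tt jt jt'.
  exact: apart tt jt' jt.
rewrite -(card_in_imset finj) (@leq_trans #|[set Some j | j : 'I_D]%SET|) //.
  apply: subset_leq_card; apply/fintype.subsetP => _ /imsetP[t /fP[j ftj _] ->].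
  by rewrite ftj; apply: imset_f.
by rewrite card_imset ?card_ord //; exact: Some_inj.
Qed.

End partitions.

(** * Cells of itineraries and good levels *)

Section good_level.
Context (R : realType) (X Y : metricType R) (T : X -> X) (S : Y -> Y).
Context (phi : X -> Y) (w : R) (K : finType) (p : Y -> K).
Implicit Types (e r : R) (G : set X) (n m : nat) (x : X).

Definition itinerary n x : {ffun 'I_n -> K} := [ffun k : 'I_n => p (iter k S (phi x))].

Definition bad_times r n x : {set 'I_n} :=
  [set k : 'I_n | near_boundary p r (iter k S (phi x))]%SET.

Definition cell G n x : set X := G `&` [set x' | itinerary n x' = itinerary n x].

Definition cell_covnum e G n x : nat := covnum (bowen_dist T n) e (cell G n x).

Lemma cell_le G n m x : (m <= n)%N -> cell G n x `<=` cell G m x.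
Proof.
move=> mn x' [Gx' /ffunP xx']; split=> //; apply/ffunP => k.
by have := xx' (widen_ord mn k); rewrite !ffunE.
Qed.

Lemma small_weighted e n (A : set X) : 0 < e ->
  (forall y y', p y = p y' -> mdist y y' < e) ->
  (forall x x', A x -> A x' -> itinerary n x = itinerary n x') ->
  small (bowen_dist T (ceil_mul w n)) e A ->
  small (weighted_dist T S phi w n) e A.
Proof.
move=> e0 pe Ait sA x x' Ax Ax'; rewrite /weighted_dist gt_max.
apply/andP; split; first exact: sA.
apply/bowen_dist_lt => // k kn; apply: pe.
by have /ffunP/(_ (Ordinal kn)) := Ait x x' Ax Ax'; rewrite !ffunE.
Qed.

(** Compare with one point [x0] of [G] over [W]: at a time which is not bad for
    [x0], the orbits of all points over [W] are in the same cell as that of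
    [x0], so an itinerary is determined by its values at the at most [q] bad
    times of [x0]. *)
Lemma card_itineraries r n q G (W : set Y) :
  small (bowen_dist S n) r W -> 0 < r ->
  (forall x, G x -> (#|bad_times r n x| <= q)%N) -> (0 < #|K|)%N ->
  (#|[set c | `[< exists2 x, G x /\ W (phi x) & itinerary n x = c >]]%SET|
     <= #|K| ^ q)%N.
Proof.
move=> sW r0 Gq K0.
have [[x0 [Gx0 Wx0]]|none] := pselect (exists x, G x /\ W (phi x)); last first.
  rewrite (_ : [set c | _]%SET = finset.set0) ?cards0 //.
  apply/setP => c; rewrite !inE; apply/negbTE/negP => /asboolP[x h _].
  by apply: none; exists x.
apply: (@leq_trans (#|K| ^ #|bad_times r n x0|)); last by rewrite leq_pexp2l ?Gq.
apply: leq_trans (card_agree_off (itinerary n x0) (bad_times r n x0)).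
apply: subset_leq_card; apply/fintype.subsetP => c; rewrite !inE.
move=> [x [Gx Wx] <-]; apply/forallP => k; apply/implyP.
rewrite inE !ffunE; apply: contraNT => neq; apply/asboolP.
exists (iter k S (phi x)) => //.
by apply: (bowen_dist_lt S n (phi x0) (phi x) r0).1 => //; exact: sW.
Qed.

(** The points of a cell of level [n] lie in one cell of level [ceil (w n)], whose
    pieces have small weighted diameter after intersection with the former; at
    the points considered their number is at most [b * a_n(c)^w]. Subadditivity
    of [t^w] bounds [a_n(c)^w] by the sum of the weights of the [V j] that meet
    [c], and each [V j] meets at most [#|K|^q] cells. *)
Lemma good_level_covered e r n q C G Om l (V : 'I_l -> set Y) b :
  0 <= w <= 1 -> 0 < e -> 0 < r -> (0 < #|K|)%N ->
  (forall y y', p y = p y' -> mdist y y' < e) ->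
  covered (@mdist R X) e setT C ->
  G `<=` Om -> (forall x, G x -> (#|bad_times r n x| <= q)%N) ->
  Om `<=` \bigcup_j (phi @^-1` V j) ->
  (forall j, small (bowen_dist S n) r (V j)) -> 0 <= b ->
  exists2 k, covered (weighted_dist T S phi w n) e
      [set x | G x /\ (cell_covnum e G (ceil_mul w n) x)%:R
                        <= b * (cell_covnum e G n x)%:R `^ w] k
    & k%:R <= b * (#|K| ^ q)%:R *
        \sum_(j < l) if Om `&` phi @^-1` V j == set0 then 0
          else (covnum (bowen_dist T n) e (Om `&` phi @^-1` V j))%:R `^ w.
Proof.
move=> w01 e0 r0 K0 pe CX GOm Gq OmV sV b0; set A := [set x | _].
have CT m := covered_bowen T m e0 CX.
pose F (c : {ffun 'I_n -> K}) : set X := G `&` [set x | itinerary n x = c].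
pose u c : R := if `[< F c !=set0 >]
  then (covnum (bowen_dist T n) e (F c))%:R `^ w else 0.
have /choice[k kP] c : exists k,
    covered (weighted_dist T S phi w n) e (A `&` F c) k /\ k%:R <= b * u c.
  have [[x [[Gx xA] [_ /= xc]]]|none] := pselect ((A `&` F c) !=set0); last first.
    exists 0%N; split; last by rewrite mulr_ge0 // /u; case: ifP; rewrite ?powR_ge0.
    exists (fun _ => set0) => [z Az|[]//]; case: none; by exists z.
  exists (cell_covnum e G (ceil_mul w n) x); split; last first.
    rewrite /u asboolT; last by exists x.
    by move: xA; rewrite {2}/cell_covnum /cell xc.
  have [] := covnumP (covered_sub (@subsetT _ (cell G (ceil_mul w n) x)) (CT (ceil_mul w n))).
  move=> [U cU sU] _; exists (fun i => A `&` F c `&` U i) => [z [Az Fz]|i].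
    have /cU[i _ Uz] : cell G (ceil_mul w n) x z.
      apply: (cell_le (ceil_mul_le n w01)); case: Fz => Gz /= zc.
      by split=> //=; rewrite zc.
    by exists i.
  apply: small_weighted => //.
    by move=> z z' [[_ [_ /= ->]] _] [[_ [_ /= ->]] _].
  by apply: small_sub (sU i) => z [].
exists (\sum_c k c)%N.
  apply: covered_bigcup (fun c => (kP c).1) => x Ax.
  by exists (itinerary n x) => //; split=> //; split=> //; case: Ax.
pose v j : R := if Om `&` phi @^-1` V j == set0 then 0
  else (covnum (bowen_dist T n) e (Om `&` phi @^-1` V j))%:R `^ w.
rewrite -[X in _ <= _ * X]/(\sum_j v j).
have v0 j : 0 <= v j by rewrite /v; case: ifP; rewrite ?powR_ge0.
(* Only the V j over which c has a point of G may enter, as the term of an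
   empty intersection would be 1 when w = 0. *)
pose meets c j := `[< exists2 x, G x /\ V j (phi x) & itinerary n x = c >].
have uv c : u c <= \sum_(j | meets c j) v j.
  rewrite /u; case: asboolP => [Fc0|_]; last exact: sumr_ge0.
  have cF : (0 < covnum (bowen_dist T n) e (F c))%N.
    by apply: covnum_gt0 Fc0; apply: covered_sub (CT n).
  have le : (covnum (bowen_dist T n) e (F c) <=
      \sum_(j | meets c j) covnum (bowen_dist T n) e (Om `&` phi @^-1` V j))%N.
    apply: covnum_bigcup (CT n) _ => x [Gx /= xc].
    have [j _ Vx] := OmV x (GOm x Gx); exists j => /=.
      by apply/asboolP; exists x.
    by split=> //; exact: GOm.
  apply: (@le_trans _ _ ((\sum_(j | meets c j)
      (covnum (bowen_dist T n) e (Om `&` phi @^-1` V j))%:R) `^ w)).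
    have /andP[w0 _] := w01.
    apply: ge0_ler_powR; rewrite // ?nnegrE ?ler0n ?sumr_ge0 //.
    by rewrite -natr_sum ler_nat.
  apply: le_trans (powR_sum_le _ _ _) _ => //.
    by rewrite -natr_sum ltr0n (leq_trans cF).
  apply: ler_sum => j /asboolP[x [Gx Vx] _]; rewrite /v ifF //.
  apply/negP => /eqP h; have : set0 x by rewrite -h; split=> //; exact: GOm.
  by [].
rewrite natr_sum -mulrA.
apply: (@le_trans _ _ (\sum_c b * u c)); first by apply: ler_sum => c _; exact: (kP c).2.
rewrite -mulr_sumr ler_wpM2l //.
apply: le_trans (ler_sum _ (fun c _ => uv c)) _.
rewrite (exchange_big_dep xpredT) //= mulr_sumr.
apply: ler_sum => j _; rewrite sumr_const -[v j *+ _]mulr_natl ler_wpM2r // ler_nat.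
apply: leq_trans (card_itineraries (sV j) r0 Gq K0).
by apply: eq_leq; apply: eq_card => c; rewrite !inE.
Qed.

End good_level.

(** * Comparison of the two entropies *)

Lemma lee_of_real_bounds (R : realType) (x y : \bar R) :
  (forall h : R, (x < h%:E)%E -> (y <= h%:E)%E) -> (y <= x)%E.
Proof.
case: x => [x| |] xy; last 2 first.
- by rewrite leey.
- case: y xy => [y| |] // xy; last by have := xy 0 (ltNyr 0).
  by have := xy (y - 1) (ltNyr _); rewrite lee_fin leNgt gtrDl ltrN10.
apply/lee_addgt0Pr => d d0; rewrite -EFinD; apply: xy.
by rewrite lte_fin ltrDl.
Qed.

Section comparison.
Context (R : realType) (X Y : metricType R) (T : X -> X) (S : Y -> Y).
Context (phi : X -> Y) (w : R) (Om : set X).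
Context (w01 : 0 <= w <= 1).
Implicit Types (e r h d s : R) (n N : nat).

Definition cover_weight e n l (V : 'I_l -> set Y) : R :=
  \sum_(j < l) if Om `&` phi @^-1` V j == set0 then 0
    else (covnum (bowen_dist T n) e (Om `&` phi @^-1` V j))%:R `^ w.

(** What a strict upper bound [h] on the covering entropy at scale [r] provides.
    The covering sets of [Y] have the fine scale [r], whereas the fibres are
    counted at the coarse scale [e] of the Feng--Huang sums. *)
Definition has_light_covers e r h := exists n1, forall n, (n1 <= n)%N ->
  exists l (V : 'I_l -> set Y), [/\ forall j, small (bowen_dist S n) r (V j),
    Om `<=` \bigcup_j (phi @^-1` V j) & cover_weight e n V <= expR (h * n%:R)].

Lemma top_entropy_at_light e r h : r <= e ->
  (top_entropy_at T S phi w r Om < h%:E)%E -> has_light_covers e r h.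
Proof.
move=> re; rewrite /top_entropy_at /limn_esup limf_esupE.
move=> /ereal_inf_lt[_ /= [F [n1 _ n1F] <-] Fh].
exists n1.+1 => n nn1.
set W := weighted_cover_number T S phi w n r Om.
have W0 : (0 <= W)%E by exact: weighted_cover_number_ge0.
have {Fh} : (lne W * (n%:R^-1)%:E < h%:E)%E.
  by apply: le_lt_trans Fh; apply: ereal_sup_ubound; exists n => //; apply/n1F/ltnW.
have n0 : 0 < n%:R :> R by rewrite ltr0n (leq_trans _ nn1).
have {W0} lnW : (lne W * (n%:R^-1)%:E < h%:E)%E -> (W < (expR (h * n%:R))%:E)%E.
  move: W0; case: W => [x| |] x0 //; last first.
    by rewrite /= gt0_mulye // lte_fin invr_gt0.
  have [->|xn0] := eqVneq x 0; first by rewrite lte_fin expR_gt0.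
  have xp : 0 < x by rewrite lt_neqAle eq_sym xn0 -lee_fin.
  rewrite lne_EFin // -EFinM !lte_fin ltr_pdivrMr // => lx.
  by rewrite -[x]lnK ?posrE // ltr_expR.
move=> /lnW /ereal_inf_lt[_ /= [l [V [_ OmV dV ->]]] lt].
exists l, V; split=> [j|x Omx|].
- exact: small_diam (dV j).
- by have [|j _ Vx] := OmV (phi x); [exists x|exists j].
rewrite -lee_fin; apply: le_trans (ltW lt); rewrite -sumEFin.
apply: lee_sum => j _; case: ifP => // _; rewrite -poweR_EFin.
have /andP[w0 _] := w01.
by apply: gt0_ler_poweR; rewrite // ?in_itv /= ?leey ?andbT ?lee_fin
  ?cover_number_ge0 ?covnum_le_cover_number.
Qed.

Context (Om0 : Om !=set0).

(** The Feng--Huang critical value is an infimum over nonnegative rates, hence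
    the need for this sign. *)
Lemma light_growth_ge0 e r h C : covered (@mdist R X) e setT C -> 0 < e ->
  has_light_covers e r h -> 0 <= h.
Proof.
move=> CX e0 [n1 /(_ n1.+1 (leqnSn _))[l [V [_ OmV]]]].
have [x Omx] := Om0; have [j _ Vx] := OmV x Omx.
move=> le; have : 1 <= expR (h * n1.+1%:R).
  apply: le_trans le; rewrite /cover_weight (bigD1 j) //=.
  rewrite ifF; last first.
    by apply/negP => /eqP j0; have : set0 x by rewrite -j0.
  rewrite ler_wpDr //.
    by apply: sumr_ge0 => i _; case: ifP; rewrite ?powR_ge0.
  have /andP[w0 _] := w01.
  apply: (@le_trans _ _ (1 `^ w)); first by rewrite powR1.
  apply: ge0_ler_powR; rewrite // ?nnegrE ?ler0n // ler1n.
  apply: (@covnum_gt0 _ _ _ _ _ (C ^ n1.+1)); last by exists x.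
  by apply: covered_sub (covered_bowen _ _ e0 CX).
by rewrite -expR0 ler_expR pmulr_lge0 ?ltr0n.
Qed.

(** The heart of the argument: the [3 * d] pays for the defect [exp (d n)] allowed
    at a good level, for the number of cells met by a covering set, and for the
    decay that makes the sums tend to [0]. *)
Lemma FH_pre_le0 e d : compact [set: X] -> compact [set: Y] -> 0 < e -> 0 < d ->
  exists2 r, 0 < r <= e & forall h, has_light_covers e r h ->
    forall N, (FH_pre T S phi w (h + 3 * d) N e Om <= 0)%E.
Proof.
move=> cX cY e0 d0; have /andP[w0 w1] := w01.
have [x0 Omx0] := Om0.
have [C CX] := compact_covered cX e0.
have C1 : (0 < C)%N by have [U /(_ x0 I)[i _ _] _] := CX; exact: leq_ltn_trans (ltn_ord i).
have lnC : 0 <= ln (C%:R : R) by rewrite ln_ge0 // ler1n.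
have [D DP] := shifted_partitions cY e0.
have [L LP] := chain_descent w01 lnC d0.
(* With M partitions the bad times have frequency at most L * D / M, and a free
   choice among D.+1 cells at these times costs a factor at most exp (d n). *)
pose M := (Num.truncn ((L * D)%:R * ln D.+1%:R / d)).+1.
have MP : (L * D)%:R / M%:R * ln D.+1%:R <= d.
  rewrite mulrAC ler_pdivrMr ?ltr0n // -ler_pdivrMl // mulrC.
  by apply: ltW; exact: truncnS_gt.
have [r [p [/andP[r0 re] pe pD]]] := DP M.
exists r; first by rewrite r0.
move=> h [n1 light] N.
have bound N' : (N <= N')%N -> (n1 < N')%N ->
    (FH_pre T S phi w (h + 3 * d) N e Om <= (M%:R * L%:R * expR (- (d * N'%:R)))%:E)%E.
  move=> NN' n1N'; have [n [nN' nL]] := LP N'.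
  pose m i := iter i (ceil_mul w) n.
  have mN' (i : 'I_L) : (N' <= m i)%N by exact: nN'.
  pose q i : nat := Num.truncn ((L * D)%:R / M%:R * (m i)%:R : R).
  pose G (t : 'I_M) := [set x | Om x /\
    forall i : 'I_L, (#|bad_times S phi (p t) r (m i) x| <= q i)%N].
  pose a t i x := cell_covnum T S phi (p t) e (G t) (m i) x.
  (* The points for which partition u.1 is suitable and level u.2 is good. *)
  pose A (u : 'I_M * 'I_L) := [set x | G u.1 x /\
    (a u.1 u.2.+1 x)%:R <= expR (d * (m u.2)%:R) * (a u.1 u.2 x)%:R `^ w].
  have OmA : Om `<=` \bigcup_u A u.
    move=> x Omx.
    have [|i||t tP] := @average_good R M L D (fun i => m i)
        (fun t k => near_boundary (p t) r (iter k S (phi x))) => //.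
      by apply: leq_trans (mN' i); apply: leq_trans n1N'.
    have Gtx : G t x.
      split=> // i; rewrite /q truncn_ge_nat; first exact: tP.
      by rewrite mulr_ge0 // divr_ge0.
    have a0 i : (0 < a t i x)%N.
      apply: (@covnum_gt0 _ _ _ _ _ (C ^ m i)); last by exists x.
      by apply: covered_sub (covered_bowen _ _ e0 CX).
    have [i||i iL ai] := nL (fun i => ln (a t i x)%:R).
    - by rewrite ln_ge0 // ler1n.
    - rewrite mulr_natr -lnXn ?ltr0n // ler_ln ?posrE ?exprn_gt0 ?ltr0n //.
      rewrite -natrX ler_nat; apply: (covnumP _).2.
      by apply: covered_sub (covered_bowen _ _ e0 CX).
    exists (t, Ordinal iL) => //; split=> //=.
    rewrite -[leLHS]lnK ?posrE ?ltr0n //.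
    rewrite /powR ifF; last by apply/negbTE; rewrite pnatr_eq0 -lt0n.
    by rewrite -expRD ler_expR addrC.
  have /choice[k kP] (u : 'I_M * 'I_L) : exists k,
      covered (weighted_dist T S phi w (m u.2)) e (A u) k /\
      k%:R <= expR ((h + 2 * d) * (m u.2)%:R).
    have [|l [V [sV OmV le]]] := light (m u.2).
      by apply: leq_trans (mN' u.2); exact: ltnW.
    have K0 : (0 < #|{: option 'I_D}|)%N by rewrite card_option.
    have [||k kA kle] := good_level_covered (q := q u.2) T w01 e0 r0 K0 (pe u.1) CX _ _
        OmV sV (expR_ge0 (d * (m u.2)%:R)) (G := G u.1).
    - by move=> x [].
    - by move=> x [_]; apply.
    exists k; split=> //; apply: (le_trans kle).
    have -> : (h + 2 * d) * (m u.2)%:R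
      = d * (m u.2)%:R + d * (m u.2)%:R + h * (m u.2)%:R by ring.
    rewrite !expRD; apply: ler_pM => //; rewrite ?mulr_ge0 ?expR_ge0 //.
      by apply: sumr_ge0 => j _; case: ifP; rewrite ?powR_ge0.
    rewrite ler_pM2l ?expR_gt0 // card_option card_ord natrX.
    rewrite -[X in X ^+ _]lnK ?posrE ?ltr0n // -expRM_natl ler_expR.
    apply: (@le_trans _ _ ((L * D)%:R / M%:R * (m u.2)%:R * ln D.+1%:R)).
      rewrite ler_wpM2r ?ln_ge0 ?ler1n // /q.
      have x0' : 0 <= (L * D)%:R / M%:R * (m u.2)%:R :> R.
        by rewrite mulr_ge0 // divr_ge0.
      by have /andP[] := truncn_itv x0'.
    by rewrite mulrAC ler_wpM2r.
  have Nm (u : 'I_M * 'I_L) : (N <= m u.2)%N by exact: leq_trans (mN' u.2).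
  apply: le_trans (FH_pre_le _ x0 OmA Nm (fun u => (kP u).1)) _.
  rewrite lee_fin.
  apply: (@le_trans _ _ (\sum_(u : 'I_M * 'I_L) expR (- (d * N'%:R)))); last first.
    by rewrite sumr_const card_prod !card_ord -[X in X <= _]mulr_natl natrM.
  apply: ler_sum => u _.
  apply: (@le_trans _ _ (expR (- (d * (m u.2)%:R)))).
    have -> : - (d * (m u.2)%:R) =
      (h + 2 * d) * (m u.2)%:R + - ((h + 3 * d) * (m u.2)%:R) by ring.
    by rewrite expRD ler_wpM2r ?expR_ge0 // (kP u).2.
  by rewrite ler_expR lerN2 ler_wpM2l ?ler_nat // ltW.
apply/lee_addgt0Pr => eps eps0; rewrite add0e.
(* exp (- x) <= 1 / x makes the bound smaller than eps for this N'. *)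
pose N' := maxn (maxn N n1.+1) (Num.truncn (M%:R * L%:R / (d * eps) : R)).+1.
have [NN' [nN' tN']] : (N <= N')%N /\ (n1 < N')%N /\
    ((Num.truncn (M%:R * L%:R / (d * eps) : R)) < N')%N.
  by rewrite /N' !leq_max !leqnn ?orbT.
apply: le_trans (bound N' NN' nN') _; rewrite lee_fin.
have : M%:R * L%:R / (d * eps) <= N'%:R :> R.
  by apply: le_trans (ltW (truncnS_gt _)) _; rewrite ler_nat.
rewrite ler_pdivrMr ?mulr_gt0 // => key.
rewrite expRN ler_pdivrMr ?expR_gt0 //; apply: (le_trans key).
have : 1 + d * N'%:R <= expR (d * N'%:R) by exact: expR_ge1Dx.
have := mulr_ge0 (ltW d0) (ler0n R N'); nra.
Qed.

Lemma has_light_covers_le e r r' h : r <= r' ->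
  has_light_covers e r h -> has_light_covers e r' h.
Proof.
move=> rr' [n1 H]; exists n1 => n /H[l [V [sV OmV le]]].
exists l, V; split=> // j y y' Vy Vy'.
exact: lt_le_trans (sV j y y' Vy Vy') rr'.
Qed.

Lemma FH_critical_le e d : compact [set: X] -> compact [set: Y] -> 0 < e -> 0 < d ->
  \forall r \near 0^'+,
    (FH_critical T S phi w Om e - (3 * d)%:E <= top_entropy_at T S phi w r Om)%E.
Proof.
move=> cX cY e0 d0; have [r0 /andP[r00 re] H] := FH_pre_le0 cX cY e0 d0.
have [C CX] := compact_covered cX e0.
near=> r.
have rr0 : r <= r0 by near: r; exact: nbhs_right_le.
apply: lee_of_real_bounds => h /(top_entropy_at_light (le_trans rr0 re)) light.
have h0 := light_growth_ge0 CX e0 light.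
rewrite leeBlDr // -EFinD.
apply: ereal_inf_lbound; exists (h + 3 * d) => //; split.
  by rewrite addr_ge0 // mulr_ge0 // ltW.
rewrite FH_premeasureE; apply/eqP; rewrite eq_le; apply/andP; split.
  apply: ge_ereal_sup => _ [N _ <-]; apply: H.
  exact: has_light_covers_le light.
apply: (le_trans (FH_pre_ge0 T S phi w Om _ 0%N e)).
by apply: ereal_sup_ubound; exists 0%N.
Unshelve. all: by end_near.
Qed.

End comparison.

Unset Implicit Arguments.

Theorem theorem1p1 (R : realType) (X Y : metricType R)
    (T : X -> X) (S : Y -> Y) (phi : X -> Y) (w : R) (Om : set X)
    (cptX : compact [set: X]) (cptY : compact [set: Y])
    (contT : continuous T) (contS : continuous S) (contphi : continuous phi)
    (equivariant : phi \o T = S \o phi)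
    (w_ge0 : 0 <= w) (w_le1 : w <= 1) :
  (FH_entropy T S phi w Om <= top_entropy T S phi w Om)%E.
Proof.
rewrite /FH_entropy /top_entropy; case: ifPn => // /set0P Om0.
have w01 : 0 <= w <= 1 by rewrite w_ge0 w_le1.
apply: lime_le; first exact: is_cvg_FH_entropy_at.
near=> e; have e0 : 0 < e by [].
rewrite FH_entropy_atE; apply/lee_addgt0Pr => d d0; rewrite -leeBlDr //.
apply: lime_ge; first exact: is_cvg_top_entropy_at.
have -> : d = 3 * (d / 3) by field.
by apply: FH_critical_le; rewrite ?divr_gt0.
Unshelve. all: by end_near.
Qed.
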